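(* For every partition $\lambda$, the misère Grundy value of $\lambda$ in \textsc{RIT} equals the misère Grundy value of $\mathrm{rem}(\lambda)$ in \textsc{Nim}: $\mathcal{G}^-_{\textsc{RIT}}(\lambda)=\mathcal{G}^-_{\textsc{Nim}}(\mathrm{rem}(\lambda))$.
   Context: An \textsc{RIT} (Row Impartial Terminus) position is a partition $\lambda=(\lambda_1,\dots,\lambda_r)$, written as a nonincreasing tuple of nonnegative integers (a move keeps the length $r$ of the tuple, zero entries being allowed; the empty partition is the unique terminal position). For $k\in[1,\lambda_1]$, there is a move from $\lambda$ to $\bar\lambda$ where $\bar\lambda_i=k-1$ for $i$ the largest index with $\lambda_i\ge k$, and $\bar\lambda_j=\lambda_j$ for $j\ne i$. Informally, a move shortens one row of the Young diagram so that the result is still a Young diagram. Define $\mathrm{rem}(\lambda)$ to be the $\lceil r/2\rceil$-tuple $(\lambda_1-\lambda_2,\lambda_3-\lambda_4,\dots,\lambda_{2\lceil r/2\rceil-1}-\lambda_{2\lceil r/2\rceil})$, where $\lambda_j=0$ for $j>r$. \textsc{Nim} is played on tuples of nonnegative integers: a move decreases exactly one coordinate by a positive amount; its terminal positions are the all-zero tuples (including the empty tuple). The misère Grundy value $\mathcal{G}^-$ is defined recursively by $\mathcal{G}^-(x)=1$ if $x$ is terminal and $\mathcal{G}^-(x)=\mathrm{mex}\{\mathcal{G}^-(y): x\to y\}$ otherwise, where $\mathrm{mex}(S)$ is the least nonnegative integer not in $S$. *)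

(* Defs.v *)
From mathcomp Require Import all_boot.
From mathcomp Require Import zify.

Set Implicit Arguments.
Unset Strict Implicit.
Unset Printing Implicit Defensive.

Lemma mex_subproof (s : seq nat) : exists n, n \notin s.
Proof.
exists (\max_(i <- s) i).+1; apply/negP => /(@leq_bigmax_seq _ _ predT id) H.
by have := H isT; rewrite ltnn.
Qed.

Definition mex (s : seq nat) : nat := ex_minn (mex_subproof s).

Lemma eq_mex (s t : seq nat) : s =i t -> mex s = mex t.
Proof.
move=> st; rewrite /mex; case: ex_minnP => m ms mP; case: ex_minnP => n nt nP.
by apply/eqP; rewrite eqn_leq mP ?st // nP // -st.
Qed.

Record game := Game {
  position :> choiceType;
  options : position -> seq position;
  options_wf : well_founded (fun y x => y \in options x)
}.

Section MisereGrundy.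
Variable G : game.

(* seq_sub (options x) is the type of the options of x, each carrying the     *)
(* membership proof that justifies the recursive call.                        *)
Definition misere_grundy_step (x : G)
    (rec : forall y : G, y \in options x -> nat) : nat :=
  if nilp (options x) then 1
  else mex [seq rec (ssval y) (ssvalP y) | y : seq_sub (options x)].

Definition misere_grundy : G -> nat :=
  Fix (@options_wf G) (fun=> nat) misere_grundy_step.

Lemma misere_grundyE (x : G) :
  misere_grundy x = if nilp (options x) then 1
                    else mex [seq misere_grundy y | y <- options x].
Proof.
rewrite /misere_grundy Fix_eq => [|{}x f g fg]; rewrite /misere_grundy_step.
  case: nilp => //; apply: eq_mex => n; apply/codomP/mapP => [[y ->]|[y yx ->]].
    by exists (ssval y) => //; apply: ssvalP.
  by exists (SeqSub yx).
by case: nilp => //; congr mex; apply: eq_map => y; apply: fg.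
Qed.

End MisereGrundy.

Arguments misere_grundy : clear implicits.

Lemma wf_measure (T : Type) (f : T -> nat) (r : T -> T -> Prop) :
  (forall y x, r y x -> f y < f x) -> well_founded r.
Proof.
move=> rf x; move: {2}(f x).+1 (ltnSn (f x)) => n.
elim: n x => [|n IH] x le_x; first by rewrite ltn0 in le_x.
by constructor=> y /rf lt_y; apply: IH; apply: leq_trans lt_y _.
Qed.

Lemma sumn_set_nth_lt (s : seq nat) (i m : nat) :
  m < nth 0 s i -> sumn (set_nth 0 s i m) < sumn s.
Proof.
move=> lt_m; have lt_i : i < size s.
  by rewrite ltnNge; apply/negP => /(nth_default 0) E; rewrite E in lt_m.
rewrite sumn_set_nth lt_i; move: (leq_ltn_trans (leq0n _) lt_m) => gt0.
have le_n : nth 0 s i <= sumn s.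
  elim: s i {lt_m lt_i gt0} => [|a s IH] [|i] //=; first exact: leq_addr.
  by apply: leq_trans (IH i) (leq_addl _ _).
lia.
Qed.

Definition nim_options (x : seq nat) : seq (seq nat) :=
  [seq set_nth 0 x i m | i <- iota 0 (size x), m <- iota 0 (nth 0 x i)].

Lemma nim_options_wf : well_founded (fun y x => y \in nim_options x).
Proof.
apply: (@wf_measure _ sumn) => y x /allpairsPdep[i [m [_ lt_m ->]]].
by apply: sumn_set_nth_lt; rewrite mem_iota in lt_m.
Qed.

Definition Nim : game := Game nim_options_wf.

Definition ptn : Type := {la : seq nat | sorted geq la}.

(* Rows are indexed from 0; the maximum over no rows is the junk value 0,  *)
(* which does not arise for k in [1, head 0 la].                              *)
Definition last_row (la : seq nat) (k : nat) : nat :=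
  \max_(i < size la | k <= nth 0 la i) i.

Definition shorten_row (la : seq nat) (k : nat) : seq nat :=
  set_nth 0 la (last_row la k) k.-1.

Lemma nonincr_nth (la : seq nat) :
  sorted geq la <-> forall i, nth 0 la i.+1 <= nth 0 la i.
Proof.
split=> [/(sortedP 0) H i|H]; last by apply/(sortedP 0) => i _; apply: H.
have [/H//|le_s] := ltnP i.+1 (size la).
by rewrite nth_default.
Qed.

Lemma last_row_gt (la : seq nat) (k j : nat) :
  last_row la k < j -> nth 0 la j <= k.-1.
Proof.
move=> lt_j; rewrite leqNgt; apply/negP => gt_k.
have lt_s : j < size la.
  by rewrite ltnNge; apply/negP => /(nth_default 0) E; rewrite E in gt_k.
have le_k : k <= nth 0 la (Ordinal lt_s) by move: gt_k => /=; lia.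
have := @leq_bigmax_cond _ (fun i : 'I_(size la) => k <= nth 0 la i)
  (fun i => i : nat) _ le_k.
by rewrite leqNgt lt_j.
Qed.

Lemma last_row_lt (la : seq nat) (k j : nat) :
  sorted geq la -> j < last_row la k -> k <= nth 0 la j.
Proof.
move=> /nonincr_nth dec lt_j.
have [i0 Pi0|none] := pickP (fun i : 'I_(size la) => k <= nth 0 la i).
  have : 0 < #|[pred i : 'I_(size la) | k <= nth 0 la i]|.
    by apply/card_gt0P; exists i0.
  case/(eq_bigmax_cond (fun i : 'I_(size la) => i : nat)) => i Pi Ei.
  have {}Ei : last_row la k = i by [].
  rewrite Ei in lt_j; apply: leq_trans Pi _.
  rewrite -(subnKC (ltnW lt_j)); elim: (i - j) => [|d IH]; first by rewrite addn0.
  by rewrite addnS; apply: leq_trans (dec _) IH.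
by rewrite /last_row big_pred0 in lt_j.
Qed.

Lemma shorten_row_sorted (la : seq nat) (k : nat) :
  sorted geq la -> sorted geq (shorten_row la k).
Proof.
move=> s_la; apply/nonincr_nth => j; have /nonincr_nth dec := s_la.
rewrite !nth_set_nth /=; have := @last_row_gt la k; have := @last_row_lt la k.
case: eqP => [E1|ne1] lt gt; case: eqP => [E2|ne2] //.
- by have := lt j s_la; rewrite -E1; lia.
- by apply: gt; rewrite -E2.
Qed.

Definition rit_move (la : ptn) (k : nat) : ptn :=
  exist _ (shorten_row (val la) k) (shorten_row_sorted k (valP la)).

Definition rit_options (la : ptn) : seq ptn :=
  [seq rit_move la k | k <- iota 1 (head 0 (val la))].

Lemma nth_last_row (la : seq nat) (k : nat) :
  0 < k <= head 0 la -> k <= nth 0 la (last_row la k).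
Proof.
case: la => [|a la] /andP[k_gt0 k_le]; first by move: k_le => /=; lia.
have : 0 < #|[pred i : 'I_(size (a :: la)) | k <= nth 0 (a :: la) i]|.
  by apply/card_gt0P; exists ord0.
case/(eq_bigmax_cond (fun i : 'I_(size (a :: la)) => i : nat)) => i Pi Ei.
by have -> : last_row (a :: la) k = i by [].
Qed.

Lemma rit_options_wf : well_founded (fun y x => y \in rit_options x).
Proof.
apply: (@wf_measure _ (fun la : ptn => sumn (val la))) => y x /mapP[k + ->].
rewrite mem_iota => k_in; have := @nth_last_row (val x) k.
by move=> le_k; apply: sumn_set_nth_lt; lia.
Qed.

Definition RIT : game := Game rit_options_wf.

Definition rit_rem (la : ptn) : seq nat :=
  mkseq (fun i => nth 0 (val la) i.*2 - nth 0 (val la) i.*2.+1)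
        (uphalf (size (val la))).

(* Main.v *)
Require Import Defs.
From mathcomp Require Import all_boot.
From mathcomp Require Import zify.

Set Implicit Arguments.
Unset Strict Implicit.
Unset Printing Implicit Defensive.

(** Shortening a row of odd (1-based) index realises every Nim move on [rem],
    while shortening a row of even index increases one coordinate of [rem], a
    step that Nim can revert. An option that can be reverted to [x] never has
    the Grundy value of [x], so these extra moves do not change the mex. The
    misère convention only matters when [rem] vanishes at a nonterminal
    position: there, removing one box from the last of the longest rows makes
    [rem] a single heap of size 1, of value 0, and all options are reversible,
    so that the mex is 1. *)

Lemma mex_notin (s : seq nat) : mex s \notin s.
Proof. by rewrite /mex; case: ex_minnP. Qed.

Lemma mem_lt_mex (s : seq nat) (n : nat) : n < mex s -> n \in s.
Proof.
rewrite /mex; case: ex_minnP => m _ mP lt_n; apply/negPn/negP => /mP.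
by rewrite leqNgt lt_n.
Qed.

Lemma mex_eq (s : seq nat) (n : nat) :
  n \notin s -> (forall m, m < n -> m \in s) -> mex s = n.
Proof.
move=> ns sP; have [/mem_lt_mex|/sP|//] := ltngtP n (mex s).
  by rewrite (negPf ns).
by rewrite (negPf (mex_notin s)).
Qed.

Lemma misere_grundy_terminal (G : game) (x : G) :
  options x = [::] -> misere_grundy G x = 1.
Proof. by move=> x0; rewrite misere_grundyE x0. Qed.

Lemma misere_grundy_mex (G : game) (x y : G) : y \in options x ->
  misere_grundy G x = mex [seq misere_grundy G z | z <- options x].
Proof. by rewrite misere_grundyE; case: (options x). Qed.

Lemma misere_grundy_option_neq (G : game) (x y : G) :
  y \in options x -> misere_grundy G y != misere_grundy G x.
Proof.
move=> yx; apply/eqP => E; have /negP[] := mex_notin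
  [seq misere_grundy G z | z <- options x].
by rewrite -(misere_grundy_mex yx) -E map_f.
Qed.

Section ReversibleMap.
Variables (G H : game) (f : G -> H).

Hypothesis lift_option :
  forall x z, z \in options (f x) -> exists2 y, y \in options x & f y = z.
Hypothesis option_reversible : forall x y, y \in options x ->
  f y \in options (f x) \/ f x \in options (f y).
(** A terminal image has value 1, which is not the mex of an empty set, so a nonterminal [x] above
    it must have an option of value 0. *)
Hypothesis terminal_image : forall x, options (f x) = [::] ->
  options x = [::] \/ exists2 y, y \in options x & misere_grundy H (f y) = 0.

Lemma misere_grundy_reversible_map (x : G) :
  misere_grundy G x = misere_grundy H (f x).
Proof.
elim/(well_founded_ind (@options_wf G)): x => x IH.
have noteq y : y \in options x -> misere_grundy H (f y) != misere_grundy H (f x).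
  by case/option_reversible => /misere_grundy_option_neq; rewrite // eq_sym.
(* The option [y] only certifies that the value of [x] is a mex. As [noteq] already keeps the value
   of [f x] from being attained, just the smaller values remain to be found. *)
have mexG y : y \in options x ->
    (forall m, m < misere_grundy H (f x) ->
       exists2 z, z \in options x & misere_grundy H (f z) = m) ->
    misere_grundy G x = misere_grundy H (f x).
  move=> yx below; rewrite (misere_grundy_mex yx); apply: mex_eq => [|m].
    by apply/mapP => -[z zx E]; have := noteq z zx; rewrite -IH // -E eqxx.
  by case/below => z zx <-; apply/mapP; exists z; rewrite // IH.
case E : (options (f x)) => [|z s].
  have [x0|[y yx y0]] := terminal_image E.
    by rewrite !misere_grundy_terminal.
  apply: (mexG _ yx) => m; rewrite (misere_grundy_terminal E) => m_lt.
  by exists y; rewrite // y0; lia.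
have zfx : z \in options (f x) by rewrite E mem_head.
have [y yx _] := lift_option zfx; apply: (mexG _ yx) => m.
rewrite (misere_grundy_mex zfx) => /mem_lt_mex/mapP[t /lift_option[u ux <-] ->].
by exists u.
Qed.

End ReversibleMap.

Lemma nim_optionP (x y : seq nat) :
  reflect (exists i m, m < nth 0 x i /\ y = set_nth 0 x i m)
          (y \in nim_options x).
Proof.
apply: (iffP allpairsPdep) => [[i [m [_ + ->]]]|[i [m [lt_m ->]]]].
  by rewrite mem_iota => lt_m; exists i, m.
exists i, m; rewrite !mem_iota; split=> //=.
by rewrite ltnNge; apply/negP => /(nth_default 0) E; rewrite E in lt_m.
Qed.

Lemma nim_option_decrease (x : seq nat) (i m : nat) :
  m < nth 0 x i -> set_nth 0 x i m \in nim_options x.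
Proof. by move=> lt_m; apply/nim_optionP; exists i, m. Qed.

(** The bound on [i] keeps [set_nth] from padding [x] with zeros, so that restoring the old entry
    gives back [x] itself. *)
Lemma nim_option_increase (x : seq nat) (i m : nat) :
  i < size x -> nth 0 x i < m -> x \in nim_options (set_nth 0 x i m).
Proof.
move=> lt_i gt_m; apply/nim_optionP; exists i, (nth 0 x i).
rewrite nth_set_nth /= eqxx; split=> //; rewrite set_set_nth eqxx.
apply: (@eq_from_nth _ 0) => [|j _]; first by rewrite size_set_nth; lia.
by rewrite nth_set_nth /=; case: eqP => // ->.
Qed.

Lemma nim_options_sumn0 (x : seq nat) : sumn x = 0 -> nim_options x = [::].
Proof.
move=> x0; case E : (nim_options x) => [|y s] //.
have /nim_optionP[i [m [/sumn_set_nth_lt + _]]] : y \in nim_options x.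
  by rewrite E mem_head.
by rewrite x0.
Qed.

Lemma nim_options_nil_nth (x : seq nat) (i : nat) :
  nim_options x = [::] -> nth 0 x i = 0.
Proof.
move=> x0; apply/eqP; rewrite -leqn0 leqNgt; apply/negP => gt0.
by have := nim_option_decrease gt0; rewrite x0.
Qed.

Lemma nim_options_nil_sumn (x : seq nat) : nim_options x = [::] -> sumn x = 0.
Proof.
move=> x0; rewrite sumnE (big_nth 0) big1 // => i _.
exact: nim_options_nil_nth.
Qed.

(** Every option has sum 0, hence is terminal of value 1, and 0 is the least value missing. *)
Lemma misere_grundy_nim_sumn1 (x : seq nat) :
  sumn x = 1 -> misere_grundy Nim x = 0.
Proof.
move=> x1; case E : (nim_options x) => [|y s].
  by rewrite nim_options_nil_sumn in x1.
have yx : y \in nim_options x by rewrite E mem_head.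
rewrite (@misere_grundy_mex Nim x y) //; apply: mex_eq => //.
apply/mapP => -[z /nim_optionP[i [m [/sumn_set_nth_lt lt_m zE]]]].
rewrite misere_grundy_terminal //; apply: nim_options_sumn0; subst z.
by lia.
Qed.

Lemma nth_le_head (la : seq nat) (i : nat) :
  sorted geq la -> nth 0 la i <= head 0 la.
Proof.
move=> /nonincr_nth dec; rewrite -nth0; elim: i => // i.
exact: leq_trans.
Qed.

Lemma last_row_eq (la : seq nat) (k i : nat) : sorted geq la ->
  0 < k -> nth 0 la i.+1 < k <= nth 0 la i -> last_row la k = i.
Proof.
move=> s_la k_gt0 /andP[lt_k le_k]; have [lt_i|gt_i|//] := ltngtP (last_row la k) i.
  by have := last_row_gt lt_i; lia.
have le_head : k <= head 0 la.
  exact: leq_trans le_k (nth_le_head i s_la).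
have := @nth_last_row la k; rewrite k_gt0 le_head => /(_ isT).
(* If the chosen row came after row [i], then row [i.+1] would either precede it or be it, and so
   have length at least [k]. *)
have [lt_i1|ge_i1] := ltnP i.+1 (last_row la k).
  by have := last_row_lt s_la lt_i1; lia.
have -> : last_row la k = i.+1 by lia.
by lia.
Qed.

Lemma last_row_lt_size (la : seq nat) (k : nat) :
  0 < k <= head 0 la -> last_row la k < size la.
Proof.
move=> k_in; have := nth_last_row k_in.
have [//|/(nth_default 0) ->] := ltnP (last_row la k) (size la); lia.
Qed.

Lemma mem_rit_options (la : ptn) (k : nat) :
  0 < k <= head 0 (val la) -> rit_move la k \in rit_options la.
Proof. by move=> k_in; apply: map_f; rewrite mem_iota; lia. Qed.

Lemma size_rit_rem (la : ptn) : size (rit_rem la) = uphalf (size (val la)).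
Proof. exact: size_mkseq. Qed.

Lemma nth_rit_rem (la : ptn) (j : nat) :
  nth 0 (rit_rem la) j = nth 0 (val la) j.*2 - nth 0 (val la) j.*2.+1.
Proof.
have [lt_j|ge_j] := ltnP j (uphalf (size (val la))); first by rewrite nth_mkseq.
(* Past the end, row [j.*2] is the default 0 and the truncated difference vanishes too. *)
rewrite nth_default ?size_rit_rem // (nth_default 0 (n := j.*2)) //.
by lia.
Qed.

(** Row [i] enters only coordinate [i./2], as the subtrahend if [i] is odd and as the minuend
    otherwise. Rows count from 0 here, so an odd [i] is a row of even 1-based index. *)
Lemma rit_rem_move (la : ptn) (k i : nat) :
  0 < k <= head 0 (val la) -> last_row (val la) k = i ->
  rit_rem (rit_move la k) = set_nth 0 (rit_rem la) i./2
    (if odd i then nth 0 (val la) i.-1 - k.-1 else k.-1 - nth 0 (val la) i.+1).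
Proof.
move=> k_in Ei; have := last_row_lt_size k_in; rewrite Ei => lt_i.
have size_la : size (shorten_row (val la) k) = size (val la).
  by rewrite size_set_nth Ei; lia.
apply: (@eq_from_nth _ 0).
  by rewrite size_set_nth !size_rit_rem /= size_la; lia.
move=> j _; rewrite nth_rit_rem nth_set_nth /= nth_rit_rem !nth_set_nth /= Ei.
have [->|ne_j] := eqVneq j i./2; last first.
  by rewrite !ifF //; lia.
have [odd_i|even_i] := boolP (odd i).
  have -> : i./2.*2 = i.-1 by lia.
  have -> : i.-1.+1 = i by lia.
  by rewrite eqxx ifF //; lia.
have -> : i./2.*2 = i by lia.
by rewrite eqxx ifF //; lia.
Qed.

Lemma rit_rem_lift (la : ptn) (z : seq nat) : z \in nim_options (rit_rem la) ->
  exists2 mu, mu \in rit_options la & rit_rem mu = z.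
Proof.
case/nim_optionP => j [m []]; rewrite nth_rit_rem => lt_m ->.
(* This [k] shortens row [j.*2] to exceed the next row by exactly [m]; the bound on [m] puts [k]
   strictly above the next row and at most at row [j.*2]. *)
set k := (nth 0 (val la) j.*2.+1 + m).+1.
have E : last_row (val la) k = j.*2.
  by apply: last_row_eq; [exact: valP|rewrite /k; lia..].
have k_in : 0 < k <= head 0 (val la).
  by apply: leq_trans (nth_le_head j.*2 (valP la)); rewrite /k; lia.
exists (rit_move la k); first exact: mem_rit_options.
rewrite (rit_rem_move k_in E) odd_double doubleK; congr set_nth; exact: addKn.
Qed.

Lemma rit_rem_reversible (la mu : ptn) : mu \in rit_options la ->
  rit_rem mu \in nim_options (rit_rem la) \/
  rit_rem la \in nim_options (rit_rem mu).
Proof.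
case/mapP => k; rewrite mem_iota => k_iota ->.
have k_in : 0 < k <= head 0 (val la) by lia.
have lt_i := last_row_lt_size k_in; have le_k := nth_last_row k_in.
(* The row below the shortened one has length at most [k.-1], so no subtraction is truncated. *)
have gt_i := last_row_gt (ltnSn (last_row (val la) k)).
have /nonincr_nth dec := valP la.
rewrite (rit_rem_move k_in erefl); set i := last_row _ _ in lt_i le_k gt_i *.
have [odd_i|even_i] := boolP (odd i); [right|left].
  have Ei : i./2.*2 = i.-1 by lia.
  have Si : i.-1.+1 = i by lia.
  apply: nim_option_increase; first by rewrite size_rit_rem; lia.
  by have := dec i.-1; rewrite nth_rit_rem Ei Si; lia.
have Ei : i./2.*2 = i by lia.
by apply: nim_option_decrease; rewrite nth_rit_rem Ei; lia.
Qed.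

Lemma rit_rem_terminal (la : ptn) : nim_options (rit_rem la) = [::] ->
  rit_options la = [::] \/
  exists2 mu, mu \in rit_options la & misere_grundy Nim (rit_rem mu) = 0.
Proof.
move=> rem0; case E : (head 0 (val la)) => [|h].
  by left; rewrite /rit_options E.
right; have k_in : 0 < h.+1 <= head 0 (val la) by rewrite E ltnSn.
exists (rit_move la h.+1); first exact: mem_rit_options.
have lt_i := last_row_lt_size k_in; have le_k := nth_last_row k_in.
have gt_i := last_row_gt (ltnSn (last_row (val la) h.+1)).
apply: misere_grundy_nim_sumn1; rewrite (rit_rem_move k_in erefl).
set i := last_row _ _ in lt_i le_k gt_i *.
have := nim_options_nil_nth i./2 rem0; rewrite nth_rit_rem => rem_i.
(* Row [i] is strictly longer than row [i.+1]; for even [i] their difference would be a nonzero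
   coordinate of [rit_rem la]. *)
have odd_i : odd i.
  apply/negPn/negP => even_i; have Ei : i./2.*2 = i by lia.
  by rewrite Ei in rem_i; lia.
rewrite odd_i sumn_set_nth (nim_options_nil_sumn rem0) size_rit_rem.
rewrite (nim_options_nil_nth _ rem0); have := nth_le_head i.-1 (valP la).
(* Row [i.-1] thus has the maximal length [h.+1], and its difference with the new row of length [h]
   is 1. *)
have : h.+1 <= nth 0 (val la) i.-1.
  by apply: last_row_lt (valP la) _; rewrite -/i; lia.
by lia.
Qed.

Theorem theorem4p1 (la : ptn) :
  misere_grundy RIT la = misere_grundy Nim (rit_rem la).
Proof.
apply: (@misere_grundy_reversible_map RIT Nim rit_rem).
- exact: rit_rem_lift.
- exact: rit_rem_reversible.
- exact: rit_rem_terminal.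
Qed.
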